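(* For every prime power $q$, the number $J_{\mathrm{GH}}(q)$ of distinct $j$-invariants of generalized Hessian curves over $\mathbb{F}_q$ is $$J_{\mathrm{GH}}(q)=\begin{cases}q-1,& q\equiv0\pmod3,\\ \lfloor (3q+1)/4\rfloor,& q\equiv1\pmod3,\\ \lfloor q/2\rfloor,& q\equiv2\pmod3.\end{cases}$$
   Context: For $u,v\in\mathbb{F}_q$ with $v\ne0$ and $u^3\ne27v$, the generalized Hessian curve $E_{\mathrm{GH},u,v}$ is the elliptic curve $X^3+Y^3+v=uXY$ over $\mathbb{F}_q$, with $j(E_{\mathrm{GH},u,v})=\frac1v\left(\frac{u(u^3+216v)}{u^3-27v}\right)^3$. $J_{\mathrm{GH}}(q)=\#\{j(E_{\mathrm{GH},u,v}): u,v\in\mathbb{F}_q,\ v\ne0,\ u^3\ne27v\}$. *)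

(* Defs.v *)
From HB Require Import structures.
From mathcomp Require Import all_boot all_order all_algebra all_field.
Set Implicit Arguments. Unset Strict Implicit. Unset Printing Implicit Defensive.
Import GRing.Theory.
Local Open Scope ring_scope.

(* Parameters (u,v) defining a generalized Hessian curve X^3+Y^3+v = uXY:
   v <> 0 and u^3 <> 27 v. *)
Definition GH_param (F : fieldType) (u v : F) : bool :=
  (v != 0) && (u ^+ 3 != 27%:R * v).

Definition jGH (F : fieldType) (u v : F) : F :=
  v^-1 * (u * (u ^+ 3 + 216%:R * v) / (u ^+ 3 - 27%:R * v)) ^+ 3.

Definition J_GH (F : finFieldType) : nat :=
  #|[set jGH uv.1 uv.2 | uv in [set uv : F * F | GH_param uv.1 uv.2]]|.

Definition J_GH_formula (q : nat) : nat :=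
  (if q %% 3 == 0 then q - 1
   else if q %% 3 == 1 then (3 * q + 1) %/ 4
   else q %/ 2)%N.

(* Main.v *)
Require Import Defs.
From HB Require Import structures.
From mathcomp Require Import all_boot all_order all_algebra all_field.
From mathcomp Require Import all_fingroup all_solvable ring zify.
Set Implicit Arguments. Unset Strict Implicit. Unset Printing Implicit Defensive.
Import GRing.Theory.
Local Open Scope ring_scope.

(** The j-invariant is f(t) = t ((t + 216) / (t - 27))^3 with t = u^3 / v, so the
    task is to count the values of f on F minus {27}; in characteristic 3, f is
    the identity. Otherwise f(d^3) = g(d)^3 with
    g(d) = d (d^3 + 216) / (d^3 - 27), and away from the cube roots of 1728 the
    fibers of g are orbits of the group generated by d |-> 3 (d + 6) / (d - 3) and
    its conjugates by the cube roots of unity in F.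
    If q = 2 mod 3, cubing is bijective and the fibers of g have two elements
    (one over 0 in characteristic 2): the fixed points of the involution share
    the value 12 of g.
    If q = 1 mod 3, f preserves both cubes and non-cubes. It is injective on
    non-cubes: f(s) = f(t) gives s = k^3 t, and k <> 1 would make the norm of
    k theta^2 - 3 (1 + k) theta - 18 vanish, where theta^3 = t. On cubes, the
    fibers of g have four elements, except over the cube roots of 1728, where
    they are half as large (or reduced to 0 in characteristic 2), and the
    nonzero values of g fall into triples with the same cube. *)

(** * Counting finite sets by fibers *)

(** The predicate [P] on values lets generic and exceptional fibers, which differ in size, be
    counted separately. *)
Lemma card_fiberwise (T T' : finType) (h : T -> T') (A : {set T})
    (P : pred T') (k : nat) :
  (forall x, x \in A -> P (h x) -> #|[set y in A | h y == h x]| = k) ->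
  #|[set x in A | P (h x)]| = (k * #|[set z in h @: A | P z]|)%N.
Proof.
move=> hk; rewrite -sum1_card.
rewrite (partition_big h (mem [set z in h @: A | P z])) /=; last first.
  by move=> x; rewrite !inE => /andP[Ax ->]; rewrite imset_f.
rewrite mulnC -sum_nat_const; apply: eq_bigr => z.
rewrite inE => /andP[/imsetP[x Ax ->] Px].
rewrite sum1dep_card -(hk x Ax Px); apply: eq_card => y; rewrite !inE -andbA.
by case: (h y =P h x) => [->|]; rewrite ?Px ?andbF.
Qed.

Lemma cards_split (T : finType) (A : {set T}) (P : pred T) :
  #|A| = (#|[set x in A | P x]| + #|[set x in A | ~~ P x]|)%N.
Proof.
rewrite -(cardsID [set x | P x] A); congr (_ + _)%N; apply: eq_card => x.
  by rewrite !inE.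
by rewrite !inE andbC.
Qed.

Lemma card_sub1 (T : finType) (A : {set T}) x :
  x \in A -> #|[set y in A | y == x]| = 1%N.
Proof.
move=> Ax; apply/eqP/cards1P; exists x; apply/setP => y.
by rewrite !inE; case: eqP => [->|]; rewrite ?Ax ?andbF.
Qed.

(** * The j-map, its cube root and the involution over an arbitrary field *)

Section Fibers.
Variable F : fieldType.
Implicit Types a b c d e s t w z : F.

Definition jt t := t * ((t + 216%:R) / (t - 27%:R)) ^+ 3.

(** A cube root of the j-invariant of the Hessian curve [X^3 + Y^3 + 1 = dXY]. *)
Definition jroot d := d * (d ^+ 3 + 216%:R) / (d ^+ 3 - 27%:R).

Definition hinv d := 3%:R * (d + 6%:R) / (d - 3%:R).

Lemma jGH_jt u v : v != 0 -> u ^+ 3 != 27%:R * v -> jGH u v = jt (u ^+ 3 / v).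
Proof.
move=> v0 uv; rewrite /jGH /jt; field.
by rewrite v0 mulNr subr_eq0 uv.
Qed.

Lemma jt_cube d : jt (d ^+ 3) = jroot d ^+ 3.
Proof. by rewrite [jroot d]/jroot -[d * _ / _]mulrA exprMn. Qed.

Lemma cube27_neq3 d : d ^+ 3 != 27%:R -> d - 3%:R != 0.
Proof. by apply: contraNneq => /subr0_eq ->; apply/eqP; ring. Qed.

(** The numerator of [jroot d - 12] is the square of the quadratic that also detects the fixed
    points of [hinv]; hence 12 is the exceptional value. *)
Lemma jroot_eq12 d : d ^+ 3 != 27%:R ->
  (jroot d == 12%:R) = (d ^+ 2 - 6%:R * d - 18%:R == 0).
Proof.
move=> d3; rewrite -subr_eq0.
have -> : jroot d - 12%:R = (d ^+ 2 - 6%:R * d - 18%:R) ^+ 2 / (d ^+ 3 - 27%:R).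
  by rewrite /jroot; field; rewrite subr_eq0.
by rewrite mulf_eq0 invr_eq0 subr_eq0 (negPf d3) orbF expf_eq0.
Qed.

Lemma hinv_fixed d : d - 3%:R != 0 ->
  (hinv d == d) = (d ^+ 2 - 6%:R * d - 18%:R == 0).
Proof.
move=> d3; rewrite eq_sym -subr_eq0.
have -> : d - hinv d = (d ^+ 2 - 6%:R * d - 18%:R) / (d - 3%:R).
  by rewrite /hinv; field.
by rewrite mulf_eq0 invr_eq0 (negPf d3) orbF.
Qed.

Lemma hinv_cube d : 3%:R != 0 :> F -> d ^+ 3 != 27%:R -> hinv d ^+ 3 != 27%:R.
Proof.
move=> n3 d3; have d3' := cube27_neq3 d3.
rewrite -subr_eq0.
have -> : hinv d ^+ 3 - 27%:R =
    3%:R ^+ 6 * (d ^+ 2 + 3%:R * d + 9%:R) / (d - 3%:R) ^+ 3.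
  by rewrite /hinv; field.
rewrite !mulf_neq0 ?invr_eq0 ?expf_neq0 //.
apply: contraNneq d3 => h; rewrite -subr_eq0.
by rewrite -(mulr0 (d - 3%:R)) -h; apply/eqP; ring.
Qed.

Lemma jroot_hinv d : 3%:R != 0 :> F -> d ^+ 3 != 27%:R ->
  jroot (hinv d) = jroot d.
Proof.
move=> n3 d3; have d3' := cube27_neq3 d3; have h3 := hinv_cube n3 d3.
apply/eqP; rewrite /jroot eqr_div ?subr_eq0 //; apply/eqP; rewrite /hinv; field.
by [].
Qed.

(* Over a field with a primitive cube root of unity, the quadratic form splits
   and accounts for the two remaining points of the fiber. *)
Lemma jroot_eq d e : d ^+ 3 != 27%:R -> e ^+ 3 != 27%:R -> jroot e = jroot d ->
  [\/ e = d, e = hinv d |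
   let x := d * e + 3%:R * (d + e) in let y := 18%:R - 3%:R * (d + e) in
   x ^+ 2 + x * y + y ^+ 2 = 0].
Proof.
move=> d3 e3 /eqP; rewrite /jroot eqr_div ?subr_eq0 // -subr_eq0.
set x := d * e + 3%:R * (d + e); set y := 18%:R - 3%:R * (d + e).
have -> : e * (e ^+ 3 + 216%:R) * (d ^+ 3 - 27%:R) -
          d * (d ^+ 3 + 216%:R) * (e ^+ 3 - 27%:R) =
   (e - d) * (d * e - 3%:R * (d + e) - 18%:R) * (x ^+ 2 + x * y + y ^+ 2).
  by rewrite /x /y; ring.
rewrite !mulf_eq0 => /orP[/orP[]|]; last by move/eqP; constructor 3.
  by rewrite subr_eq0 => /eqP; constructor 1.
move=> /eqP h; constructor 2; have d3' := cube27_neq3 d3.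
apply: (mulIf d3'); rewrite /hinv divfK //; apply/eqP.
by rewrite -subr_eq0 -h; apply/eqP; ring.
Qed.

(* Multiplying a theta^2 + b theta + c, where theta^3 = t, by a theta - b turns
   its norm into that of a linear polynomial in theta, whose vanishing makes t
   a cube. *)
Lemma cubic_norm_eq0 a b c t : a != 0 ->
  a ^+ 3 * t ^+ 2 + b ^+ 3 * t + c ^+ 3 - 3%:R * a * b * c * t = 0 ->
  exists d, t = d ^+ 3.
Proof.
move=> a0 h.
have h1 : (a * c - b ^+ 2) ^+ 3 * t + (a ^+ 2 * t - b * c) ^+ 3 = 0.
  by rewrite -[RHS](mul0r (a ^+ 3 * t - b ^+ 3)) -h; ring.
(* If the coefficient of theta vanishes, so does the constant term, and then
   [a ^+ 3 * t = a * b * c = b ^+ 3]. *)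
have [r0|r0] := eqVneq (a * c - b ^+ 2) 0.
  move: h1; rewrite r0 expr0n mul0r add0r => /eqP; rewrite expf_eq0 /= => /eqP s0.
  exists (b / a); apply: (mulIf (expf_neq0 3 a0)).
  rewrite expr_div_n divfK ?expf_neq0 //; apply/eqP; rewrite -subr_eq0.
  rewrite [X in X == 0](_ : _ = a * (a ^+ 2 * t - b * c) + b * (a * c - b ^+ 2)).
    by rewrite r0 s0 !mulr0 addr0.
  by ring.
exists (- (a ^+ 2 * t - b * c) / (a * c - b ^+ 2)).
apply: (mulIf (expf_neq0 3 r0)); rewrite expr_div_n divfK ?expf_neq0 //.
by apply/eqP; rewrite -subr_eq0 -h1; apply/eqP; ring.
Qed.


Lemma jt_noncube_inj s t : s != 27%:R -> t != 27%:R ->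
  (forall d, t <> d ^+ 3) -> jt s = jt t -> s = t.
Proof.
rewrite -subr_eq0 -[t == _]subr_eq0 => s27 t27 nt; rewrite /jt.
set rs := (s + _) / _; set rt := (t + _) / _ => e.
(* Both 0 and [- 216 = (- 6) ^+ 3] are cubes, so [t] and [t + 216] are nonzero. *)
have t0 : t != 0 by apply/eqP => h; apply: (nt 0); rewrite h expr0n.
have rt0 : rt != 0.
  rewrite mulf_neq0 ?invr_eq0 //; apply/eqP => /eqP.
  by rewrite addr_eq0 => /eqP h; apply: (nt (- 6%:R)); rewrite h; ring.
have rs0 : rs != 0.
  apply: contra_eq_neq e => ->.
  by rewrite expr0n mulr0 eq_sym mulf_neq0 // expf_neq0.
(* Since [s * rs ^+ 3 = t * rt ^+ 3], the quotient of [s] by [t] is the cube of this ratio. *)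
pose k := rt / rs.
have k0 : k != 0 by rewrite mulf_neq0 ?invr_eq0.
have sk : s = k ^+ 3 * t.
  apply: (mulIf (expf_neq0 3 rs0)); rewrite e /k [RHS]mulrAC.
  by rewrite -exprMn divfK // mulrC.
have : k * rs = rt by rewrite divfK.
rewrite /rs /rt sk => /eqP; rewrite mulrA eqr_div -?sk // sk -subr_eq0.
have -> : k * (k ^+ 3 * t + 216%:R) * (t - 27%:R) -
          (t + 216%:R) * (k ^+ 3 * t - 27%:R) =
  (k - 1) * (k ^+ 3 * t ^+ 2 + (- 3%:R * (1 + k)) ^+ 3 * t + (- 18%:R) ^+ 3
     - 3%:R * k * (- 3%:R * (1 + k)) * (- 18%:R) * t).
  by ring.
rewrite mulf_eq0 subr_eq0 => /orP[/eqP ->|/eqP]; first by rewrite expr1n mul1r.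
by case/(cubic_norm_eq0 k0) => d /nt.
Qed.

(** Away from characteristic 3 the two polynomials are coprime: a Bezout combination of them equals
    [3 ^+ 6]. *)
Lemma cube27_twelve d : 3%:R != 0 :> F -> d ^+ 2 - 6%:R * d - 18%:R = 0 ->
  d ^+ 3 != 27%:R.
Proof.
move=> n3 Q; rewrite -subr_eq0; apply: contra_neq (expf_neq0 6 n3) => h.
rewrite [LHS](_ : _ = (2%:R * d - 15%:R) * (d ^+ 3 - 27%:R -
  (d + 6%:R) * (d ^+ 2 - 6%:R * d - 18%:R)) -
  108%:R * (d ^+ 2 - 6%:R * d - 18%:R)); last by ring.
by rewrite Q h !mulr0 !subr0 mulr0.
Qed.

(** This equivariance turns the symmetry [hinv] of [jroot] into the conjugate symmetries
    [c * hinv (c ^+ 2 * d)]. *)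
Lemma jrootM c d : c ^+ 3 = 1 -> jroot (c * d) = c * jroot d.
Proof. by move=> c3; rewrite /jroot exprMn c3 mul1r !mulrA. Qed.

(** * Primitive cube roots of unity and the conjugates of the involution *)

Section Omega.
Variable w : F.
Hypotheses (n3 : 3%:R != 0 :> F) (hw : w ^+ 2 + w + 1 = 0).

Lemma omega_cube : w ^+ 3 = 1.
Proof.
apply/eqP; rewrite -subr_eq0 -(mulr0 (w - 1)) -hw; apply/eqP; ring.
Qed.

Lemma omega_neq0 : w != 0.
Proof.
apply: contra_eq_neq omega_cube => ->.
by rewrite expr0n eq_sym oner_eq0. Qed.

Lemma omega_neq1 : w != 1.
Proof.
apply: contraNneq n3 => w1; rewrite -hw w1; apply/eqP; ring.
Qed.

(** The other primitive cube root satisfies the same equation, so the lemmas on [w] also apply to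
    [w ^+ 2]. *)
Lemma omega_sqr : (w ^+ 2) ^+ 2 + w ^+ 2 + 1 = 0.
Proof. by rewrite -(mulr0 (w ^+ 2 - w + 1)) -hw; ring. Qed.

Lemma eqf_cubes x y :
  (x ^+ 3 == y ^+ 3) = [|| x == y, x == w * y | x == w ^+ 2 * y].
Proof.
rewrite -subr_eq0 -[x == y]subr_eq0 -[x == w * y]subr_eq0.
rewrite -[x == w ^+ 2 * y]subr_eq0 -!mulf_eq0; congr (_ == 0).
apply/eqP; rewrite -subr_eq0.
rewrite [X in X == 0](_ : _ =
  (w ^+ 2 + w + 1) * ((x - y) * (x * y - (w - 1) * y ^+ 2))); last by ring.
by rewrite hw mul0r.
Qed.

(** The hypothesis is one factor, [x = w * y], of the quadratic form in [jroot_eq]; it is linear in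
    [e] and can be solved. *)
Lemma eq_omega_hinv d e : d ^+ 3 != 27%:R ->
  d * e + 3%:R * (d + e) = w * (18%:R - 3%:R * (d + e)) ->
  e = w ^+ 2 * hinv (w * d).
Proof.
move=> d3 h; have wd3 : w * d - 3%:R != 0.
  by apply: cube27_neq3; rewrite exprMn omega_cube mul1r.
apply: (mulIf wd3); rewrite /hinv mulrA divfK //; apply/eqP; rewrite -subr_eq0.
rewrite [X in X == 0](_ : _ = w * (d * e + 3%:R * (d + e)
  - w * (18%:R - 3%:R * (d + e))) - 3%:R * (e + w * d) * (w ^+ 2 + w + 1)).
  by rewrite h hw subrr !mulr0 subr0.
by ring.
Qed.

(** The two sides agree only if [w * d] is a root of the exceptional quadratic, which would give
    [jroot (w * d) = 12]. *)
Lemma hinv_neq_omega_hinv d : d ^+ 3 != 27%:R -> jroot d ^+ 3 != 12%:R ^+ 3 ->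
  hinv d != w * hinv (w ^+ 2 * d).
Proof.
move=> d3 N; have d3' := cube27_neq3 d3.
have w2 : (w ^+ 2) ^+ 3 = 1 by rewrite exprAC omega_cube expr1n.
have wd3 : w ^+ 2 * d - 3%:R != 0.
  by apply: cube27_neq3; rewrite exprMn w2 mul1r.
have w10 : w - 1 != 0 by rewrite subr_eq0 omega_neq1.
(* The vanishing multiple of [w ^+ 2 + w + 1] is kept so that the identity holds for a formal
   [w]. *)
rewrite -subr_eq0 [X in X != 0](_ : _ = 3%:R * (w - 1) *
  (3%:R * d * (w ^+ 2 + w + 1) - ((w * d) ^+ 2 - 6%:R * (w * d) - 18%:R)) /
  ((d - 3%:R) * (w ^+ 2 * d - 3%:R))).
  rewrite hw mulr0 sub0r !mulf_neq0 ?invr_eq0 ?mulf_neq0 //.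
  rewrite oppr_eq0 -jroot_eq12; last by rewrite exprMn omega_cube mul1r.
  rewrite jrootM ?omega_cube //; apply: contraNneq N => <-.
  by rewrite [(w * _) ^+ 3]exprMn omega_cube mul1r.
rewrite /hinv; field.
by rewrite d3' wd3.
Qed.

End Omega.

(** Otherwise [c ^+ 2 * d] would be fixed by [hinv], so [jroot] would be 12 there. *)
Lemma neq_omega_hinv c d : c ^+ 3 = 1 -> d ^+ 3 != 27%:R ->
  jroot d ^+ 3 != 12%:R ^+ 3 -> d != c * hinv (c ^+ 2 * d).
Proof.
move=> c3 d3 N; have c0 : c != 0.
  by apply: contra_eq_neq c3 => ->; rewrite expr0n eq_sym oner_eq0.
have c23 : (c ^+ 2) ^+ 3 = 1 by rewrite exprAC c3 expr1n.
have cd3 : (c ^+ 2 * d) ^+ 3 != 27%:R by rewrite exprMn c23 mul1r.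
have : hinv (c ^+ 2 * d) != c ^+ 2 * d.
  rewrite hinv_fixed ?cube27_neq3 // -jroot_eq12 // jrootM //.
  by apply: contraNneq N => <-; rewrite [(_ * _) ^+ 3]exprMn c23 mul1r.
by apply: contra_neq => h; rewrite [in RHS]h mulrA -exprSr c3 mul1r.
Qed.

Lemma omega_hinv_cube c d : 3%:R != 0 :> F -> c ^+ 3 = 1 -> d ^+ 3 != 27%:R ->
  (c * hinv (c ^+ 2 * d)) ^+ 3 != 27%:R.
Proof.
move=> n3 c3 d3; rewrite exprMn c3 mul1r hinv_cube //.
by rewrite exprMn exprAC c3 expr1n mul1r.
Qed.

Lemma jroot_omega_hinv c d : 3%:R != 0 :> F -> c ^+ 3 = 1 -> d ^+ 3 != 27%:R ->
  jroot (c * hinv (c ^+ 2 * d)) = jroot d.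
Proof.
move=> n3 c3 d3; have c23 : (c ^+ 2) ^+ 3 = 1 by rewrite exprAC c3 expr1n.
have cd3 : (c ^+ 2 * d) ^+ 3 != 27%:R by rewrite exprMn c23 mul1r.
by rewrite jrootM // jroot_hinv // jrootM // mulrA -exprS c3 mul1r.
Qed.

End Fibers.

(** * Reduction to one parameter, and the count when cubing is injective *)

Section Finite.
Variable F : finFieldType.
Implicit Types a b c d e s t w z : F.

Definition jdom := [set d : F | d ^+ 3 != 27%:R].

Definition jroots := [set jroot d | d in jdom].

Definition jcubes := [set z ^+ 3 | z in jroots].

Definition cubes := [set d ^+ 3 | d in [set: F]].

Lemma J_GH_jt : J_GH F = #|[set jt t | t in [set t : F | t != 27%:R]]|.
Proof.
rewrite /J_GH; apply: eq_card => j; apply/imsetP/imsetP => [[[u v]]|[t]].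
  rewrite inE /= => /andP[v0 uv] ->; exists (u ^+ 3 / v); last exact: jGH_jt.
  rewrite inE; apply: contraNneq uv => h.
  by rewrite -h divfK.
(* A nonzero [t] comes from [(u, v) = (1, t^-1)]; the value 0 needs [u = 0]. *)
rewrite inE => t27 ->; have [t0|t0] := eqVneq t 0.
  have n27 : (0 : F) != 27%:R * 1 by rewrite mulr1 -t0.
  exists (0, 1); first by rewrite inE /GH_param /= oner_eq0 expr0n.
  by rewrite jGH_jt ?oner_eq0 ?expr0n // mul0r t0.
exists (1, t^-1); first rewrite inE /GH_param /= invr_eq0 t0 /= expr1n.
  by rewrite -(inj_eq (mulIf t0)) divfK // mul1r.
rewrite jGH_jt /= ?invr_eq0 // expr1n ?invrK ?mul1r //.
by rewrite -(inj_eq (mulIf t0)) divfK // mul1r.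
Qed.

(** The additive group is elementary abelian, so [#|F|] is a power of the characteristic. *)
Lemma natr_eq0_dvd_card p : prime p -> (p%:R == 0 :> F) = (p %| #|F|)%N.
Proof.
move=> pp; apply/idP/idP => [p0|].
  have chp : p \in [pchar F] by rewrite inE pp.
  have := abelem_pgroup (fin_ring_pchar_abelem chp); rewrite /pgroup cardsT.
  case/p_natP => -[|n] En; last by rewrite En expnS dvdn_mulr.
  by have := finNzRing_gt1 F; rewrite En.
have [r pr chr] := finPcharP F.
have := abelem_pgroup (fin_ring_pchar_abelem chr); rewrite /pgroup cardsT.
case/p_natP => n ->; rewrite Euclid_dvdX // dvdn_prime2 // => /andP[/eqP -> _].
by rewrite (pcharf0 chr).
Qed.

(** In terms of [c ^+ 2 * e] the fiber is the zero set of the exceptional quadratic, whose roots sum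
    to 6; the partner of [d] is therefore [6 * c - d]. *)
Lemma fiber_twelve c d : 2%:R != 0 :> F -> 3%:R != 0 :> F -> c ^+ 3 = 1 ->
  d \in jdom -> jroot d = c * 12%:R ->
  #|[set e in jdom | jroot e == jroot d]| = 2%N.
Proof.
move=> n2 n3 c3; rewrite inE => d3 jd.
have c0 : c != 0.
  by apply: contra_eq_neq c3 => ->; rewrite expr0n eq_sym oner_eq0.
have c23 : (c ^+ 2) ^+ 3 = 1 by rewrite exprAC c3 expr1n.
have key e : e ^+ 3 != 27%:R -> (jroot e == jroot d) =
    ((c ^+ 2 * e) ^+ 2 - 6%:R * (c ^+ 2 * e) - 18%:R == 0).
  move=> e3; have ce3 : (c ^+ 2 * e) ^+ 3 != 27%:R by rewrite exprMn c23 mul1r.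
  rewrite -jroot_eq12 // jrootM // jd.
  by rewrite -[in RHS](inj_eq (mulfI c0)) mulrA -exprS c3 mul1r.
have Qd := key _ d3; rewrite eqxx in Qd; move/esym/eqP: Qd => Qd.
have opp e : c ^+ 2 * (6%:R * c - e) = 6%:R - c ^+ 2 * e.
  by rewrite mulrBr mulrCA -exprSr c3 mulr1.
have e3 : (6%:R * c - d) ^+ 3 != 27%:R.
  have /cube27_twelve : (c ^+ 2 * (6%:R * c - d)) ^+ 2 -
      6%:R * (c ^+ 2 * (6%:R * c - d)) - 18%:R = 0.
    by rewrite -Qd opp; ring.
  by rewrite exprMn c23 mul1r; apply.
rewrite -[RHS]/(true.+1) (_ : true = (d != 6%:R * c - d)) -?cards2.
  apply: eq_card => e; rewrite !inE; apply/andP/orP => [[e27]|].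
    rewrite key // => /eqP Qe.
    have : (c ^+ 2 * e - c ^+ 2 * d) * (c ^+ 2 * e - c ^+ 2 * (6%:R * c - d)) = 0.
      by rewrite opp -[RHS](subrr 0) -{1}Qe -Qd; ring.
    move/eqP; rewrite -!mulrBr !mulf_eq0 ?expf_eq0 /= !(negPf c0) /= !subr_eq0.
    by move/orP.
  case=> /eqP->; first by rewrite eqxx.
  by rewrite e3 key // opp -Qd; split=> //; apply/eqP; ring.
(* The two roots could coincide only at [3 * c], whose cube is the excluded 27. *)
apply/esym; rewrite eq_sym subr_eq -subr_eq0.
rewrite [X in X != 0](_ : _ = 2%:R * (3%:R * c - d)); last by ring.
rewrite mulf_neq0 // subr_eq0; apply: contraNneq d3 => <-.
by rewrite exprMn c3 mulr1; apply/eqP; ring.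
Qed.

(** Here 216 vanishes and [jroot d] becomes [d ^+ 4 / (d ^+ 3 - 27)]. *)
Lemma jroot_eq0_char2 d : 2%:R = 0 :> F -> d \in jdom ->
  (jroot d == 0) = (d == 0).
Proof.
move=> h2; rewrite inE -subr_eq0 => d3.
have h216 : 216%:R = 0 :> F by rewrite -[216%N]/(2 * 108)%N natrM h2 mul0r.
by rewrite /jroot h216 addr0 -exprS mulf_eq0 invr_eq0 (negPf d3) orbF expf_eq0.
Qed.

Lemma zero_jdom : 3%:R != 0 :> F -> 0 \in jdom.
Proof.
move=> n3; rewrite inE expr0n /= eq_sym -[27%N]/(3 ^ 3)%N natrX.
by rewrite expf_neq0.
Qed.

Lemma fiber_zero_char2 : 2%:R = 0 :> F -> 3%:R != 0 :> F ->
  #|[set d in jdom | jroot d == 0]| = 1%N /\ #|[set z in jroots | z == 0]| = 1%N.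
Proof.
move=> h2 n3; have X0 := zero_jdom n3.
have j0 : jroot 0 = 0 :> F by rewrite /jroot !mul0r.
split; last by apply: card_sub1; apply/imsetP; exists 0.
rewrite -(card_sub1 X0); apply: eq_card => d; rewrite [LHS]in_set [RHS]in_set.
by apply: andb_id2l => dX; rewrite jroot_eq0_char2.
Qed.

Lemma card_jroots_cube_inj : 3%:R != 0 :> F -> injective (fun x : F => x ^+ 3) ->
  #|jroots| = (#|F| %/ 2)%N.
Proof.
move=> n3 inj3.
have cX : #|jdom| = #|F|.-1.
  rewrite -(cardC1 (3%:R : F)); apply: eq_card => d; rewrite !inE.
  by rewrite -[27%N]/(3 ^ 3)%N natrX (inj_eq inj3).
have cg : #|[set d in jdom | jroot d != 12%:R]| =
          (2 * #|[set z in jroots | z != 12%:R]|)%N.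
  apply: (card_fiberwise (P := fun z => z != 12%:R)) => d; rewrite inE => d3 j12.
  have hd : hinv d != d by rewrite hinv_fixed ?cube27_neq3 // -jroot_eq12.
  rewrite -[RHS]/(true.+1) (_ : true = (d != hinv d)) -?cards2; last first.
    by rewrite eq_sym hd.
  apply: eq_card => e; rewrite !inE; apply/andP/orP => [[e3 /eqP je]|].
    case: (jroot_eq d3 e3 je) => [->|->|] /=; rewrite ?eqxx; [by left|by right|].
    move=> /=; set x := d * e + _; set y := 18%:R - _ => xy.
    (* The quadratic form divides [x ^+ 3 - y ^+ 3], so injectivity gives [x = y]; the form is then
       [3 * y ^+ 2], and both vanish. *)
    have xy0 : x = y.
      apply: inj3; apply/eqP; rewrite -subr_eq0 -(mulr0 (x - y)) -xy.
      by apply/eqP; ring.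
    move/eqP: xy; rewrite xy0.
    rewrite [X in X == 0](_ : _ = 3%:R * y ^+ 2); last by ring.
    rewrite mulf_eq0 (negPf n3) expf_eq0 /= => /eqP y0.
    (* Three times the exceptional quadratic at [d] is a combination of [x] and [y], so it vanishes
       as well. *)
    case/negP: j12; rewrite jroot_eq12 // -(inj_eq (mulfI n3)) mulr0.
    rewrite [X in X == 0](_ : _ = - d * y - 3%:R * (x + y)); last first.
      by rewrite /x /y; ring.
    by rewrite xy0 y0 addr0 !mulr0 subr0.
  case=> /eqP->; first by rewrite eqxx.
  by rewrite hinv_cube // jroot_hinv.
have cX2 := cards_split jdom (fun d => jroot d == 12%:R).
have cZ2 := cards_split jroots (fun z => z == 12%:R).
move: cX2 cZ2 => /= cX2 cZ2.
(* For even [q] the fiber over [12 = 0] is a single point, so [q - 1 = 1 + 2 * zg]; for odd [q]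
   every nonempty fiber has two points, so [q - 1 = 2 * z]. *)
have [/eqP|n2] := boolP ((2%:R : F) == 0) => [h2|].
  have h12 : 12%:R = 0 :> F by rewrite -[12%N]/(2 * 6)%N natrM h2 mul0r.
  have q2 : (2 %| #|F|)%N by rewrite -natr_eq0_dvd_card // h2.
  have [c1 c2] := fiber_zero_char2 h2 n3.
  rewrite h12 in cg cX2 cZ2.
  have count (q x x1 xg z z1 zg : nat) : x = q.-1 -> x = (x1 + xg)%N ->
      z = (z1 + zg)%N -> xg = (2 * zg)%N -> x1 = 1%N -> z1 = 1%N ->
      (2 %| q)%N -> (1 < q)%N -> z = (q %/ 2)%N by lia.
  exact: count cX cX2 cZ2 cg c1 c2 q2 (finNzRing_gt1 F).
have q2 : ~~ (2 %| #|F|)%N by rewrite -natr_eq0_dvd_card.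
have c12 : #|[set d in jdom | jroot d == 12%:R]| =
           (2 * #|[set z in jroots | z == 12%:R]|)%N.
  apply: (card_fiberwise (P := fun z => z == 12%:R)) => d dX /eqP jd.
  by apply: (@fiber_twelve 1) => //; rewrite ?expr1n ?mul1r.
have count (q x x1 xg z z1 zg : nat) : x = q.-1 -> x = (x1 + xg)%N ->
    z = (z1 + zg)%N -> xg = (2 * zg)%N -> x1 = (2 * z1)%N ->
    ~~ (2 %| q)%N -> z = (q %/ 2)%N by lia.
exact: count cX cX2 cZ2 cg c12 q2.
Qed.

(** * Fields with a primitive cube root of unity *)

Section SplitCase.
Variable w : F.
Hypotheses (n3 : 3%:R != 0 :> F) (hw : w ^+ 2 + w + 1 = 0).

Lemma uniq_omega_orbit x : x != 0 -> uniq [:: x; w * x; w ^+ 2 * x].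
Proof.
move=> x0; have w1 := omega_neq1 n3 hw; have w0 := omega_neq0 hw.
have aux a y : a != 1 -> y != 0 -> y != a * y.
  by move=> a1 y0; apply: contra_neq a1 => h; apply: (mulIf y0); rewrite mul1r.
have w2 : w ^+ 2 != 1.
  by apply: contra_neq w1 => h; rewrite -(omega_cube hw) exprS h mulr1.
have e1 := aux w x w1 x0; have e2 := aux (w ^+ 2) x w2 x0.
have e3 := aux w (w * x) w1 (mulf_neq0 w0 x0); rewrite mulrA -expr2 in e3.
by rewrite /= !inE !negb_or e1 e2 e3.
Qed.

Lemma card_jdom_omega : (#|jdom| + 3)%N = #|F|.
Proof.
have U : uniq [:: 3%:R; w * 3%:R; w ^+ 2 * 3%:R] by exact: uniq_omega_orbit.
rewrite -[X in (_ + X)%N]/(size [:: 3%:R; w * 3%:R; w ^+ 2 * 3%:R]).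
rewrite -(card_uniqP U) -[RHS](cardC (mem [:: 3%:R; w * 3%:R; w ^+ 2 * 3%:R])) addnC.
congr (_ + _)%N; apply: eq_card => d; rewrite !inE.
by rewrite -[27%N]/(3 ^ 3)%N natrX (eqf_cubes hw).
Qed.

Lemma fiber_four d : d \in jdom -> jroot d ^+ 3 != 12%:R ^+ 3 ->
  #|[set e in jdom | jroot e == jroot d]| = 4%N.
Proof.
rewrite inE => d3 N; have w3 := omega_cube hw; have hw2 := omega_sqr hw.
have w23 : (w ^+ 2) ^+ 3 = 1 by rewrite exprAC w3 expr1n.
have w4 : (w ^+ 2) ^+ 2 = w by rewrite -exprM -[(2 * 2)%N]/(3 + 1)%N exprD w3 mul1r.
have d23 : (w ^+ 2 * d) ^+ 3 != 27%:R by rewrite exprMn w23 mul1r.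
pose s := [:: d; hinv d; w * hinv (w ^+ 2 * d); w ^+ 2 * hinv (w * d)].
have U : uniq s.
  have N2 : jroot (w ^+ 2 * d) ^+ 3 != 12%:R ^+ 3.
    by rewrite jrootM // [(_ * _) ^+ 3]exprMn w23 mul1r.
  have e1 := neq_omega_hinv (expr1n F 3) d3 N; rewrite expr1n !mul1r in e1.
  have e2 := neq_omega_hinv w3 d3 N.
  have e3 := neq_omega_hinv w23 d3 N; rewrite w4 in e3.
  have e4 := hinv_neq_omega_hinv n3 hw d3 N.
  have e5 := hinv_neq_omega_hinv n3 hw2 d3 N; rewrite w4 in e5.
  (* The last pair is the comparison [e4] taken at [w ^+ 2 * d] and multiplied by [w]. *)
  have e6 := hinv_neq_omega_hinv n3 hw d23 N2.
  rewrite [w ^+ 2 * (_ * _)]mulrA -expr2 w4 in e6.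
  rewrite -(inj_eq (mulfI (omega_neq0 hw))) [w * (w * _)]mulrA -expr2 in e6.
  by rewrite /= !inE !negb_or e1 e2 e3 e4 e5 e6.
rewrite -[RHS]/(size s) -(card_uniqP U); apply: eq_card => e; rewrite !inE.
apply/andP/or4P => [[e3 /eqP je]|].
  case: (jroot_eq d3 e3 je) => [->|->|/= ]; [by constructor 1|by constructor 2|].
  set x := d * e + _; set y := 18%:R - _ => xy.
  have : (x == w * y) || (x == w ^+ 2 * y).
    rewrite -subr_eq0 -[x == w ^+ 2 * y]subr_eq0 -mulf_eq0.
    rewrite [X in X == 0](_ : _ = (x ^+ 2 + x * y + y ^+ 2) +
      (w ^+ 2 + w + 1) * ((w - 1) * y ^+ 2 - x * y)); last by ring.
    by rewrite xy hw mul0r addr0.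
  case/orP=> /eqP h; first by constructor 4; apply/eqP/(eq_omega_hinv hw).
  constructor 3; apply/eqP; rewrite -{1}w4.
  exact: (eq_omega_hinv hw2).
case=> /eqP->; first by rewrite eqxx.
- by rewrite hinv_cube // jroot_hinv.
- by rewrite omega_hinv_cube // jroot_omega_hinv.
(* The remaining conjugate is the case [c = w ^+ 2], for which [c ^+ 2 = w]. *)
rewrite -{1 3}w4 in d3 *.
have := omega_hinv_cube n3 w23 d3; have := jroot_omega_hinv n3 w23 d3.
by rewrite w4 => -> ->.
Qed.

(** A nonzero fiber of cubing is an orbit under [w]; this serves both for the whole field and for
    [jroots]. *)
Lemma fiber_cube (A : {set F}) x : {homo *%R w : y / y \in A} ->
  x \in A -> x != 0 -> #|[set y in A | y ^+ 3 == x ^+ 3]| = 3%N.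
Proof.
move=> Aw Ax x0.
have U : uniq [:: x; w * x; w ^+ 2 * x] by exact: uniq_omega_orbit.
rewrite -[RHS]/(size [:: x; w * x; w ^+ 2 * x]) -(card_uniqP U).
apply: eq_card => y; rewrite !inE (eqf_cubes hw).
apply: andb_idl => /or3P[]/eqP-> //; first exact: Aw.
by rewrite exprSr expr1 -mulrA; apply/Aw/Aw.
Qed.

Lemma card_cubes : (#|F| + 2)%N = (3 * #|cubes|)%N.
Proof.
have c0 : 0 \in cubes by apply/imsetP; exists 0; rewrite ?expr0n.
have cC := cards_split cubes (fun y => y == 0).
have cN : #|[set x in [set: F] | x ^+ 3 != 0]| = (3 * #|[set y in cubes | y != 0%R]|)%N.
  apply: (card_fiberwise (P := fun y => y != 0)) => x xT.
  by rewrite expf_eq0 /= => x0; apply: fiber_cube => // y _; rewrite inE.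
have cN1 : #|[set x in [set: F] | x ^+ 3 != 0]| = #|F|.-1.
  by rewrite -(cardC1 (0 : F)); apply: eq_card => x; rewrite !inE expf_eq0.
have count (q c c' n : nat) : c = (1 + c')%N -> n = (3 * c')%N -> n = q.-1 ->
    (1 < q)%N -> (q + 2)%N = (3 * c)%N by lia.
rewrite card_sub1 // in cC.
exact: count cC cN cN1 (finNzRing_gt1 F).
Qed.

Lemma jroots_omega : {homo *%R w : z / z \in jroots}.
Proof.
move=> _ /imsetP[d dX ->]; apply/imsetP; exists (w * d).
  by move: dX; rewrite !inE exprMn (omega_cube hw) mul1r.
by rewrite jrootM ?(omega_cube hw).
Qed.

(** The count runs through two maps: [jroot] from [jdom] to [jroots], generically 4-to-1, then
    cubing from [jroots] to [jcubes], 3-to-1 away from 0. *)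
Lemma card_jcubes : #|jcubes| = ((#|F| + 11) %/ 12)%N.
Proof.
have X0 := zero_jdom n3.
have Z0 : 0 \in jroots by apply/imsetP; exists 0; rewrite // /jroot !mul0r.
have M0 : 0 \in jcubes by apply/imsetP; exists 0; rewrite ?expr0n.
have cX2 := cards_split jdom (fun d => jroot d ^+ 3 == 12%:R ^+ 3).
have cZ2 := cards_split jroots (fun z => z ^+ 3 == 12%:R ^+ 3).
have cZ0 := cards_split jroots (fun z => z == 0).
have cM0 := cards_split jcubes (fun m => m == 0).
rewrite card_sub1 //= in cZ0; rewrite card_sub1 //= in cM0.
have c4 : #|[set d in jdom | jroot d ^+ 3 != 12%:R ^+ 3]| =
          (4 * #|[set z in jroots | z ^+ 3 != 12%:R ^+ 3]|)%N.
  by apply: (card_fiberwise (P := fun z => z ^+ 3 != 12%:R ^+ 3)); exact: fiber_four.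
have c3 : #|[set z in jroots | z != 0]| = (3 * #|[set m in jcubes | m != 0%R]|)%N.
  rewrite -(card_fiberwise (h := fun z => z ^+ 3) (A := jroots)
             (P := fun m => m != 0) (k := 3)).
    by apply: eq_card => z; rewrite !inE expf_eq0.
  move=> z zZ; rewrite expf_eq0 /= => z0; exact: fiber_cube jroots_omega _ _.
have cX := card_jdom_omega.
have [/eqP h2|n2] := boolP ((2%:R : F) == 0).
  have [c1 c2] := fiber_zero_char2 h2 n3.
  have h12 : 12%:R = 0 :> F by rewrite -[12%N]/(2 * 6)%N natrM h2 mul0r.
  have q2 : (2 %| #|F|)%N by rewrite -natr_eq0_dvd_card // h2.
  have e1 : #|[set d in jdom | jroot d ^+ 3 == 12%:R ^+ 3]| = 1%N.
    rewrite -[RHS]c1; apply: eq_card => d.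
    by rewrite [LHS]in_set [RHS]in_set h12 expr0n expf_eq0.
  have e2 : #|[set z in jroots | z ^+ 3 == 12%:R ^+ 3]| = 1%N.
    rewrite -[RHS]c2; apply: eq_card => d.
    by rewrite [LHS]in_set [RHS]in_set h12 expr0n expf_eq0.
  (* Here [q - 4 = 4 * z4 = 12 * m3], hence [12 * m = q + 8]. *)
  have count (q x x1 x4 z z1 z4 z3 m m3 : nat) : x = (x1 + x4)%N ->
    z = (z1 + z4)%N -> z = (1 + z3)%N -> m = (1 + m3)%N -> x4 = (4 * z4)%N ->
    z3 = (3 * m3)%N -> (x + 3)%N = q -> x1 = 1%N -> z1 = 1%N ->
    m = ((q + 11) %/ 12)%N by lia.
  exact: count cX2 cZ2 cZ0 cM0 c4 c3 cX e1 e2.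
have c2 : #|[set d in jdom | jroot d ^+ 3 == 12%:R ^+ 3]| =
          (2 * #|[set z in jroots | z ^+ 3 == 12%:R ^+ 3]|)%N.
  apply: (card_fiberwise (P := fun z => z ^+ 3 == 12%:R ^+ 3)) => d dX.
  rewrite (eqf_cubes hw) => /or3P[]/eqP jd.
  - by apply: (@fiber_twelve 1) => //; rewrite ?expr1n ?mul1r.
  - by apply: (@fiber_twelve w) => //; rewrite (omega_cube hw).
  by apply: (@fiber_twelve (w ^+ 2)) => //; rewrite exprAC (omega_cube hw) expr1n.
have n12 : 12%:R != 0 :> F.
  by rewrite -[12%N]/(2 * (2 * 3))%N !natrM !mulf_neq0.
have c1 : #|[set z in jroots | z ^+ 3 == 12%:R ^+ 3]| =
          (3 * #|[set m in jcubes | m == 12%:R ^+ 3]|)%N.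
  apply: (card_fiberwise (P := fun m => m == 12%:R ^+ 3)) => z zZ z12.
  apply: fiber_cube jroots_omega _ _ => //.
  by apply: contraTneq z12 => ->; rewrite expr0n eq_sym expf_neq0.
have le1 : (#|[set m in jcubes | m == 12%:R ^+ 3]| <= 1)%N.
  rewrite -[leqRHS](cards1 (12%:R ^+ 3 : F)); apply/subset_leq_card/subsetP => m.
  by rewrite !inE => /andP[].
(* These relations give [12 * m = q + 5 + 6 * m1]. Whether [12 ^+ 3] is attained ([m1 = 1]) or not,
   the floor takes the same form. *)
have count (q x x1 x4 z z1 z4 z3 m m3 m1 : nat) : x = (x1 + x4)%N ->
  z = (z1 + z4)%N -> z = (1 + z3)%N -> m = (1 + m3)%N -> x4 = (4 * z4)%N ->
  z3 = (3 * m3)%N -> (x + 3)%N = q -> x1 = (2 * z1)%N -> z1 = (3 * m1)%N ->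
  (m1 <= 1)%N -> m = ((q + 11) %/ 12)%N by lia.
exact: count cX2 cZ2 cZ0 cM0 c4 c3 cX c2 c1 le1.
Qed.

End SplitCase.

(** * Cube roots of unity and cubing, according to [q] modulo 3 *)

Lemma exists_omega : (#|F| %% 3 == 1)%N -> exists w : F, w ^+ 2 + w + 1 = 0.
Proof.
move=> q1; have d3 : (3 %| #|[set: {unit F}]%G|)%N.
  rewrite card_finField_unit; have := finNzRing_gt1 F.
  have count (q : nat) : (q %% 3 == 1)%N -> (3 %| q.-1)%N by lia.
  by move=> _; exact: count.
have [u _ ou] := Cauchy (isT : prime 3) d3; exists (val u).
have u1 : val u != 1.
  apply/eqP => h; have u1 : u = 1%g by apply: val_inj; rewrite h.
  by move: ou; rewrite u1 order1.
have u3 : val u ^+ 3 = 1.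
  by have := expg_order u; rewrite ou => /(congr1 val); rewrite FinRing.val_unitX.
move: (val u) u1 u3 => x x1 x3.
apply: (mulfI (x := x - 1)); first by rewrite subr_eq0.
rewrite mulr0 [LHS](_ : _ = x ^+ 3 - 1); first by rewrite x3 subrr.
by ring.
Qed.

Lemma cube_inj : (#|F| %% 3 == 2)%N -> injective (fun x : F => x ^+ 3).
Proof.
(* The exponent [e] satisfies [3 * e = 2 * q - 1], and [x ^+ (2 * q - 1) = x] for every [x],
   including 0. *)
move=> q2; have cK (x : F) : x ^+ 3 ^+ (2 * (#|F| %/ 3) + 1) = x.
  have count (q : nat) : (q %% 3 == 2 -> 3 * (2 * (q %/ 3) + 1) = q.-1 + q)%N by lia.
  rewrite -exprM (count _ q2) exprD expf_card -exprSr prednK ?expf_card //.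
  exact: ltnW (finNzRing_gt1 F).
exact: (can_inj (g := fun y => y ^+ _) cK).
Qed.


(** * Cube and noncube values of the j-map, and the final counts *)

Lemma cubesP t : reflect (exists d, t = d ^+ 3) (t \in cubes).
Proof. by apply: (iffP imsetP) => [[d _ ->]|[d ->]]; exists d. Qed.

(** The map multiplies [t] by a cube; if that cube is 0, then [t = - 216 = (- 6) ^+ 3] is itself a
    cube. *)
Lemma jt_cubes t : t != 27%:R -> (jt t \in cubes) = (t \in cubes).
Proof.
move=> t27; apply/cubesP/cubesP => [[c]|[d ->]]; last first.
  by exists (jroot d); rewrite jt_cube.
rewrite /jt; set r := _ / _ => jc.
have [r0|r0] := eqVneq r 0.
  exists (- 6%:R); move/eqP: r0; rewrite mulf_eq0 invr_eq0 subr_eq0.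
  by rewrite (negPf t27) orbF addr_eq0 => /eqP->; ring.
exists (c / r); apply: (mulIf (expf_neq0 3 r0)).
by rewrite jc expr_div_n divfK ?expf_neq0.
Qed.

Lemma jt_values_cubes : [set jt t | t in [set t : F | t != 27%:R]] :&: cubes =
  jcubes.
Proof.
apply/setP => y; apply/setIP/imsetP => [[/imsetP[t]]|[_ /imsetP[d dX ->] ->]].
  rewrite inE => t27 ->; rewrite jt_cubes // => /cubesP[d td].
  exists (jroot d); last by rewrite td jt_cube.
  by apply/imsetP; exists d; rewrite // inE -td.
split; last by apply/cubesP; exists (jroot d).
by rewrite -jt_cube; apply: imset_f; move: dX; rewrite !inE.
Qed.

Lemma jt_values_noncubes : [set jt t | t in [set t : F | t != 27%:R]] :\: cubes =
  [set jt t | t in ~: cubes].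
Proof.
apply/setP => y; apply/setDP/imsetP => [[/imsetP[t]]|[t]].
  by rewrite inE => t27 ->; rewrite jt_cubes // => nt; exists t; rewrite // inE.
rewrite inE => nt ->; have t27 : t != 27%:R.
  by apply: contraNneq nt => ->; apply/cubesP; exists 3%:R; ring.
by rewrite jt_cubes //; split=> //; apply: imset_f; rewrite inE.
Qed.

Lemma card_jt_split w : 3%:R != 0 :> F -> w ^+ 2 + w + 1 = 0 ->
  #|[set jt t | t in [set t : F | t != 27%:R]]| = ((3 * #|F| + 1) %/ 4)%N.
Proof.
move=> n3 hw; rewrite -(cardsID cubes) jt_values_cubes jt_values_noncubes.
rewrite [X in (_ + X)%N]card_in_imset.
  have := card_jcubes n3 hw; have := card_cubes n3 hw; have := cardsC cubes.
  (* The noncubes contribute [c' = 2 * (q - 1) / 3], an integer that merges with the floor in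
     [m]. *)
  have count (q c c' m : nat) : (c + c')%N = q -> (q + 2)%N = (3 * c)%N ->
     m = ((q + 11) %/ 12)%N -> (m + c')%N = ((3 * q + 1) %/ 4)%N by lia.
  exact: count.
have noncube (t : F) : t \in ~: cubes -> t != 27%:R /\ forall d, t <> d ^+ 3.
  rewrite inE => nt; split=> [|d td]; last by case/cubesP: nt; exists d.
  by apply: contraNneq nt => ->; apply/cubesP; exists 3%:R; ring.
move=> s t /noncube[s27 _] /noncube[t27 nt]; exact: jt_noncube_inj.
Qed.

(** Every element is a cube here, so all values lie in [jcubes], which is in bijection with
    [jroots]. *)
Lemma card_jt_cube_inj : 3%:R != 0 :> F -> injective (fun x : F => x ^+ 3) ->
  #|[set jt t | t in [set t : F | t != 27%:R]]| = (#|F| %/ 2)%N.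
Proof.
move=> n3 inj3; rewrite -card_jroots_cube_inj // -[RHS](card_imset _ inj3).
have cubesT : cubes = [set: F].
  by apply/eqP; rewrite eqEcard subsetT (card_imset _ inj3) leqnn.
by rewrite -/jcubes -jt_values_cubes cubesT setIT.
Qed.

Lemma card_jt_char3 : 3%:R = 0 :> F ->
  #|[set jt t | t in [set t : F | t != 27%:R]]| = (#|F| - 1)%N.
Proof.
move=> h3; rewrite subn1 -(cardC1 (0 : F)).
have h27 : 27%:R = 0 :> F by rewrite -[27%N]/(3 * 9)%N natrM h3 mul0r.
have h216 : 216%:R = 0 :> F by rewrite -[216%N]/(3 * 72)%N natrM h3 mul0r.
rewrite h27 card_in_imset; first by apply: eq_card => t; rewrite !inE.
move=> s t; rewrite !inE /jt h216 h27 !addr0 !subr0 => s0 t0.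
by rewrite !divff // expr1n !mulr1.
Qed.

End Finite.

Theorem mainTheorem15 (F : finFieldType) : J_GH F = J_GH_formula #|F|.
Proof.
rewrite J_GH_jt /J_GH_formula.
have [d3|nd3] := boolP (3 %| #|F|)%N.
  have h3 : 3%:R = 0 :> F by apply/eqP; rewrite natr_eq0_dvd_card.
  by rewrite [(_ %% 3)%N == _]d3 card_jt_char3.
have n3 : 3%:R != 0 :> F by rewrite natr_eq0_dvd_card.
rewrite ifN //; have [q1|nq1] := ifPn.
  by have [w hw] := exists_omega q1; apply: card_jt_split hw.
apply: card_jt_cube_inj => //; apply: cube_inj.
have count (q : nat) : ~~ (3 %| q)%N -> (q %% 3 != 1)%N -> (q %% 3 == 2)%N by lia.
exact: count.
Qed.
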